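(* Let $c>0$ and $\pi\in(0,1)$. Let $\varepsilon_0(n)>0$ and $k=k(n)\in\{0,\dots,n-1\}$ satisfy $\pi_n:=k/n\to\pi$ and $a_n:=e^{\varepsilon_0(n)}/n\to c^2\in(0,\infty)$. Put $\delta_n:=1/(1+e^{\varepsilon_0(n)})$ and $$\lambda_0:=\frac{1-\pi}{c^2},\qquad \lambda_1:=\frac{\pi}{c^2}.$$ Let $P_n$ be the law of $D_{n,k}:=A_{n,k}-B_{n,k}$, where $A_{n,k}\sim\mathrm{Bin}(n-k,\delta_n)$ and $B_{n,k}\sim\mathrm{Bin}(k,\delta_n)$ are independent, and let $Q_n$ be the law of $D'_{n,k}:=1+A'_{n,k}-B'_{n,k}$, where $A'_{n,k}\sim\mathrm{Bin}(n-k-1,\delta_n)$ and $B'_{n,k}\sim\mathrm{Bin}(k+1,\delta_n)$ are independent. Let $D\sim\mathrm{Skellam}(\lambda_0,\lambda_1)$, i.e. $D=X-Y$ with $X\sim\mathrm{Poi}(\lambda_0)$ and $Y\sim\mathrm{Poi}(\lambda_1)$ independent, and let $(P_\infty,Q_\infty):=(\mathcal L(D),\mathcal L(1+D))$. Then $P_n\to P_\infty$ and $Q_n\to Q_\infty$ in total variation, hence $\Delta\bigl((P_n,Q_n),(P_\infty,Q_\infty)\bigr)\to0$. Moreover, with $\lambda_{0,n}:=(n-k)\delta_n$, $\lambda_{1,n}:=k\delta_n$, $\lambda'_{0,n}:=(n-k-1)\delta_n$, $\lambda'_{1,n}:=(k+1)\delta_n$, $$\mathrm{TV}(P_n,P_\infty)\le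 (n-k)\delta_n(1-e^{-\delta_n})+k\delta_n(1-e^{-\delta_n})+|\lambda_{0,n}-\lambda_0|+|\lambda_{1,n}-\lambda_1|\le n\delta_n^2+|\lambda_{0,n}-\lambda_0|+|\lambda_{1,n}-\lambda_1|,$$ $$\mathrm{TV}(Q_n,Q_\infty)\le (n-k-1)\delta_n(1-e^{-\delta_n})+(k+1)\delta_n(1-e^{-\delta_n})+|\lambda'_{0,n}-\lambda_0|+|\lambda'_{1,n}-\lambda_1|\le n\delta_n^2+|\lambda'_{0,n}-\lambda_0|+|\lambda'_{1,n}-\lambda_1|.$$
   Context: $\mathrm{TV}(\mu,\nu):=\sup_A|\mu(A)-\nu(A)|$; $\mathcal L(X)$ is the law of $X$. For binary experiments (ordered pairs of probability measures) $(P,Q)$ and $(P',Q')$, the deficiency of the first relative to the second is $\inf_K\max\{\mathrm{TV}(PK,P'),\mathrm{TV}(QK,Q')\}$ over Markov kernels $K$; the Le Cam distance $\Delta$ is the maximum of the two deficiencies. Interpretation: $n$ users, $k$ of them holding a one and $n-k$ a zero, apply binary randomized response with flip probability $\delta_n$ independently, and the messages are shuffled; $D_{n,k}$ is the number of output ones minus $k$. $D'_{n,k}$ is the number of output ones minus $k$ when the dataset has $k+1$ ones. *)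

(* Defs.v *)
From HB Require Import structures.
From mathcomp Require Import all_boot all_order all_algebra.
From mathcomp Require Import all_classical all_reals all_analysis.

Set Implicit Arguments.
Unset Strict Implicit.
Unset Printing Implicit Defensive.

Import Order.TTheory GRing.Theory Num.Theory.
Import numFieldNormedType.Exports.

Local Open Scope classical_set_scope.
Local Open Scope ring_scope.

HB.instance Definition _ := isPointed.Build int 0.
HB.instance Definition _ := @isMeasurable.Build default_measure_display
  int discrete_measurable discrete_measurable0
  discrete_measurableC discrete_measurableU.

Section integer_valued_random_variables.
Context d (T : measurableType d).

(* The difference is taken in [int]: subtraction in [nat] truncates. *)
Definition int_diff (X Y : {mfun T >-> nat}) : T -> int :=
  fun t => (X t)%:Z - (Y t)%:Z.

Lemma measurable_int_diff (X Y : {mfun T >-> nat}) :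
  measurable_fun [set: T] (int_diff X Y).
Proof.
move=> _ U _; rewrite setTI.
have -> : int_diff X Y @^-1` U =
    \bigcup_i \bigcup_(j in [set j | U (i%:Z - j%:Z)])
      (X @^-1` [set i] `&` Y @^-1` [set j]).
  apply/seteqP; split=> [t Ut|t [i _ [j Uij [Xt Yt]]]].
    by exists (X t) => //; exists (Y t).
  by rewrite /= /int_diff Xt Yt.
apply: bigcup_measurable => i _; apply: bigcup_measurable => j _.
by apply: measurableI; apply: measurable_funPTI.
Qed.

HB.instance Definition _ (X Y : {mfun T >-> nat}) :=
  isMeasurableFun.Build _ _ _ _ (int_diff X Y) (measurable_int_diff X Y).

Definition int_succ (Z : {mfun T >-> int}) : T -> int := fun t => 1 + Z t.

Lemma measurable_int_succ (Z : {mfun T >-> int}) :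
  measurable_fun [set: T] (int_succ Z).
Proof.
move=> _ U _; rewrite setTI.
exact: (measurable_funPTI Z (_ : measurable ((fun z : int => 1 + z) @^-1` U))).
Qed.

HB.instance Definition _ (Z : {mfun T >-> int}) :=
  isMeasurableFun.Build _ _ _ _ (int_succ Z) (measurable_int_succ Z).

End integer_valued_random_variables.

Definition independent_RVs d (T : measurableType d) (R : realType)
    (P : probability T R) d1 (T1 : measurableType d1) d2
    (T2 : measurableType d2) (X : {RV P >-> T1}) (Y : {RV P >-> T2}) : Prop :=
  forall (U : set T1) (V : set T2), measurable U -> measurable V ->
    P (X @^-1` U `&` Y @^-1` V) = (P (X @^-1` U) * P (Y @^-1` V))%E.

Section le_cam.
Local Open Scope ereal_scope.
Context {R : realType}.

Definition TV d (T : measurableType d) (mu nu : set T -> \bar R) : \bar R :=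
  ereal_sup [set `|mu A - nu A| | A in measurable].

Definition binary_experiment d (T : measurableType d) : Type :=
  (probability T R * probability T R)%type.

Definition kernel_image d1 (T1 : measurableType d1) d2
    (T2 : measurableType d2) (mu : probability T1 R) (K : R.-pker T1 ~> T2) :
    set T2 -> \bar R :=
  fun A => \int[mu]_x K x A.

Definition deficiency d1 (T1 : measurableType d1) d2 (T2 : measurableType d2)
    (E : binary_experiment T1) (F : binary_experiment T2) : \bar R :=
  ereal_inf
    [set Order.max (TV (kernel_image E.1 K) F.1) (TV (kernel_image E.2 K) F.2)
      | K in [set: R.-pker T1 ~> T2]].

Definition le_cam_distance d1 (T1 : measurableType d1) d2
    (T2 : measurableType d2) (E : binary_experiment T1)
    (F : binary_experiment T2) : \bar R :=
  Order.max (deficiency E F) (deficiency F E).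

End le_cam.

(* Main.v *)
Require Import Defs.
From HB Require Import structures.
From mathcomp Require Import all_boot all_order all_algebra.
From mathcomp Require Import all_classical all_reals all_analysis.
From mathcomp Require Import measurable_realfun.
From mathcomp Require Import ring lra zify.

Set Implicit Arguments.
Unset Strict Implicit.
Unset Printing Implicit Defensive.

Import Order.TTheory GRing.Theory Num.Theory.
Import numFieldNormedType.Exports.

Local Open Scope classical_set_scope.
Local Open Scope ring_scope.

(** Total variation is contracted by maps and subadditive on products, hence
    subadditive under convolution.  Bin(m, p) and Poi(m p) are the m-fold
    convolutions of Bin(1, p) and Poi(p), whose distance is at most
    p (1 - e^{-p}) because Bin(1, p) exceeds Poi(p) only at the atom 1; summing m
    such bounds compares Bin(m, p) with Poi(m p).  Two Poisson laws with rates
    r <= s differ by the convolution factor Poi(s - r), which is within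
    1 - e^{-(s - r)} of the Dirac mass at 0.  Since the laws of the differences
    are images of product measures, the bounds for the two components add up.
    The identity kernel bounds the Le Cam distance by the total variations. *)

(** * Total variation: triangle inequality, images, products, joint laws *)

Section total_variation.
Local Open Scope ereal_scope.
Context {R : realType}.

Lemma le_TV d (T : measurableType d) (mu nu : set T -> \bar R) x :
  (forall A, measurable A -> `|mu A - nu A| <= x) -> TV mu nu <= x.
Proof. by move=> h; apply: ge_ereal_sup => _ [A mA <-]; exact: h. Qed.

Lemma TV_ge d (T : measurableType d) (mu nu : set T -> \bar R) A :
  measurable A -> `|mu A - nu A| <= TV mu nu.
Proof. by move=> mA; apply: ereal_sup_ubound; exists A. Qed.

Lemma TV_ge0 d (T : measurableType d) (mu nu : set T -> \bar R) :
  0 <= TV mu nu.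
Proof. by apply: le_trans (TV_ge mu nu measurable0); exact: abse_ge0. Qed.

Lemma TV_sym d (T : measurableType d) (mu nu : probability T R) :
  TV mu nu = TV nu mu.
Proof.
rewrite /TV; congr ereal_sup; apply: eq_imagel => A mA.
rewrite -abseN fin_num_oppeB ?fin_num_measure//.
by rewrite addeC.
Qed.

Lemma TV_refl d (T : measurableType d) (mu : probability T R) : TV mu mu = 0.
Proof.
apply/eqP; rewrite eq_le TV_ge0 andbT; apply: le_TV => A mA.
by rewrite subee ?abse0 ?fin_num_measure.
Qed.

Lemma TV_triangle d (T : measurableType d) (mu rho nu : set T -> \bar R) :
  TV mu nu <= TV mu rho + TV rho nu.
Proof.
apply: le_TV => A mA.
apply: le_trans (leeD (TV_ge mu rho mA) (TV_ge rho nu mA)).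
(* The set functions may take infinite values. Since [+oo - +oo] is [-oo], any infinite value makes
   the right-hand side [+oo]. *)
case: (mu A) (rho A) (nu A) => [x| |] [y| |] [z| |] //=; rewrite ?leey//.
by rewrite -EFinD lee_fin ler_distD.
Qed.

Lemma TV_distribution d1 (T1 : measurableType d1) d2 (T2 : measurableType d2)
    (mu nu : probability T1 R) (f : {mfun T1 >-> T2}) :
  TV (distribution mu f) (distribution nu f) <= TV mu nu.
Proof.
by apply: le_TV => A mA; apply: TV_ge; exact: measurable_funPTI.
Qed.

(** [mu \x nu] integrates the [nu]-mass of the sections of an event against [mu], and each section
    contributes a difference of at most [TV nu1 nu2]. *)
Lemma TV_product_r d1 (T1 : measurableType d1) d2 (T2 : measurableType d2)
    (mu : probability T1 R) (nu1 nu2 : probability T2 R) :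
  TV (mu \x nu1) (mu \x nu2) <= TV nu1 nu2.
Proof.
apply: le_TV => A mA.
have mf (nu : probability T2 R) := measurable_fun_xsection nu mA.
have intf (nu : probability T2 R) :
    mu.-integrable setT (nu \o xsection A).
  apply: (@le_integrable _ _ _ mu setT measurableT _ (cst 1)) => //.
  - exact: mf.
  - move=> x _ /=; rewrite normr1 gee0_abs//.
    by apply: probability_le1; exact: measurable_xsection.
  - exact: finite_measure_integrable_cst.
have mB := emeasurable_funB (mf nu1) (mf nu2).
rewrite /product_measure1 -integralB//.
apply: le_trans (le_abse_integral _ measurableT mB) _.
(* As [mu] has mass one, the bound is itself the integral of a constant, and the integrands can be
   compared pointwise. *)
rewrite -[leRHS]mule1 -(probability_setT mu) -integral_cst//.
apply: ge0_le_integral => //.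
- exact: measurableT_comp mB.
- by move=> x _; apply: TV_ge; exact: measurable_xsection.
Qed.

(** The two orders of iterated integration agree on rectangles, hence everywhere by uniqueness. This
    makes slicing available in either coordinate. *)
Lemma product_measure12 d1 (T1 : measurableType d1) d2 (T2 : measurableType d2)
    (mu : probability T1 R) (nu : probability T2 R) A :
  measurable A -> (mu \x nu) A = (mu \x^ nu) A.
Proof.
by apply: product_measure_unique => //= *; rewrite product_measure2E.
Qed.

Lemma TV_product_l d1 (T1 : measurableType d1) d2 (T2 : measurableType d2)
    (mu1 mu2 : probability T1 R) (nu : probability T2 R) :
  TV (mu1 \x nu) (mu2 \x nu) <= TV mu1 mu2.
Proof.
apply: le_TV => A mA; rewrite !product_measure12//.
(* Exchanging the coordinates of the event moves the varying factor to the right, where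
   [TV_product_r] applies. *)
pose swapA := (fun yx : T2 * T1 => (yx.2, yx.1)) @^-1` A.
have mswapA : measurable swapA.
  by rewrite -[swapA]setTI; apply: measurable_swap.
have swapE (mu : probability T1 R) : (mu \x^ nu) A = (nu \x mu) swapA.
  by apply: eq_integral => y _ /=; congr (mu _).
rewrite !swapE; apply: le_trans (TV_product_r nu mu1 mu2).
exact: TV_ge.
Qed.

Lemma TV_product d1 (T1 : measurableType d1) d2 (T2 : measurableType d2)
    (mu1 mu2 : probability T1 R) (nu1 nu2 : probability T2 R) :
  TV (mu1 \x nu1) (mu2 \x nu2) <= TV mu1 mu2 + TV nu1 nu2.
Proof.
apply: le_trans (TV_triangle _ (mu2 \x nu1) _) _.
by apply: leeD; [exact: TV_product_l|exact: TV_product_r].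
Qed.

(** Independence is agreement with the product measure on rectangles; uniqueness of the product
    measure extends it to all measurable sets. *)
Lemma joint_law_independent d (T : measurableType d) (P : probability T R)
    d1 (T1 : measurableType d1) d2 (T2 : measurableType d2)
    (X : {RV P >-> T1}) (Y : {RV P >-> T2}) A :
  independent_RVs X Y -> measurable A ->
  P ((fun t => (X t, Y t)) @^-1` A) = (distribution P X \x distribution P Y) A.
Proof.
move=> XY mA.
have mXY : measurable_fun setT (fun t => (X t, Y t)).
  by apply/measurable_fun_pairP.
pose XY' : {mfun T >-> (T1 * T2)%type} :=
  HB.pack (fun t => (X t, Y t)) (isMeasurableFun.Build _ _ _ _ _ mXY).
by rewrite (@product_measure_unique _ _ _ _ _ (distribution P X)
  (distribution P Y) (distribution P XY'))//.
Qed.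
End total_variation.

(** * Laws on the natural numbers: atoms and convolution *)

Section laws_on_nat.
Local Open Scope ereal_scope.
Context {R : realType}.
Implicit Types mu nu : probability nat R.

Lemma measure_nat_esum (mu : {measure set nat -> \bar R}) A :
  mu A = \esum_(k in A) mu [set k].
Proof.
have {1}<- : \bigcup_(k in A) [set k] = A.
  by rewrite (bigcup_imset1 A id) image_id.
rewrite measure_bigcup//; last by move=> i j _ _ [x [/= -> ->]].
by rewrite nneseries_esum// set_mem_set.
Qed.

Lemma eq_measure_nat (mu nu : {measure set nat -> \bar R}) :
  (forall k, mu [set k] = nu [set k]) -> mu = nu :> (set nat -> \bar R).
Proof.
move=> munu; apply/funext => A; rewrite !measure_nat_esum.
by apply: eq_esum => k _.
Qed.

(** The excess of [mu] at [k0] pays for all its deficits elsewhere, because both total masses are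
    one. For an event missing [k0] the deficit is therefore at most that excess; complementation
    handles the other events. *)
Lemma TV_le_atom mu nu k0 :
    (forall k, k != k0 -> mu [set k] <= nu [set k]) ->
  TV mu nu <= mu [set k0] - nu [set k0].
Proof.
move=> munu.
have le_off A : ~ A k0 -> mu A <= nu A.
  move=> Ak0; rewrite !measure_nat_esum; apply: le_esum => k Ak.
  by apply: munu; apply/eqP => kk0; apply: Ak0; rewrite -kk0.
have fE (m : probability nat R) B : exists r, m B = r%:E.
  by exists (fine (m B)); rewrite fineK ?fin_num_measure.
have h A : ~ A k0 -> `|mu A - nu A| <= mu [set k0] - nu [set k0].
  move=> Ak0; have total (m : probability nat R) :
      m A + m [set k0] + m (~` (A `|` [set k0])) = 1.
    rewrite -(probability_setT m) -(setvU (A `|` [set k0])).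
    rewrite !measureU//; last by rewrite setICl.
      by rewrite addeC.
    by apply/seteqP; split => // x [Ax /= xk0]; apply: Ak0; rewrite -xk0.
  have : mu (~` (A `|` [set k0])) <= nu (~` (A `|` [set k0])).
    by apply: le_off => -[]; right.
  move: (le_off A Ak0) (total mu) (total nu).
  have [[a ->] [b ->]] := (fE mu A, fE nu A).
  have [[a1 ->] [b1 ->]] := (fE mu [set k0], fE nu [set k0]).
  have [[a2 ->] [b2 ->]] := (fE mu (~` (A `|` [set k0])),
                             fE nu (~` (A `|` [set k0]))).
  rewrite -!EFinD abse_EFin !lee_fin => ab [ea] [eb] ab2.
  by rewrite ler0_norm; lra.
apply: le_TV => A _.
(* Passing to the complement only changes the sign of the difference. *)
have [Ak0|] := pselect (A k0); last exact: h.
have /h : ~ (~` A) k0 by apply.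
rewrite !probability_setC//.
have [[a ->] [b ->]] := (fE mu A, fE nu A).
by have -> : 1 - a%:E - (1 - b%:E) = - (a%:E - b%:E);
  [rewrite -EFinN -!EFinD; congr _%:E; ring|rewrite abseN].
Qed.

(** The product sigma-algebra is not discrete by definition, but it contains the singletons, which
    are rectangles, and the space is countable. *)
Lemma measurable_nat_pair (A : set (nat * nat)) : measurable A.
Proof.
apply: countable_measurable; last exact: countableP.
move=> [i j]; have -> : [set (i, j)] = [set i] `*` [set j].
  by apply/seteqP; split => -[x y] /= [-> ->].
exact: measurableX.
Qed.

Definition add_pair (ij : nat * nat) : nat := (ij.1 + ij.2)%N.

Lemma measurable_add_pair : measurable_fun setT add_pair.
Proof. by move=> _ A _; exact: measurable_nat_pair. Qed.

HB.instance Definition _ :=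
  isMeasurableFun.Build _ _ _ _ add_pair measurable_add_pair.

Definition convolution mu nu : probability nat R :=
  distribution (mu \x nu) add_pair.

Lemma TV_convolution mu1 mu2 nu1 nu2 :
  TV (convolution mu1 nu1) (convolution mu2 nu2) <= TV mu1 mu2 + TV nu1 nu2.
Proof. exact: le_trans (TV_distribution _ _ _) (TV_product _ _ _ _). Qed.

(** The fibre of addition over [k] is the disjoint union of the [k.+1] one-point rectangles on an
    antidiagonal. *)
Lemma convolution_set1 mu nu k :
  convolution mu nu [set k] =
  \sum_(i < k.+1) mu [set (i : nat)] * nu [set (k - i)%N].
Proof.
have preimE : add_pair @^-1` [set k] =
    \big[setU/set0]_(i < k.+1) ([set (i : nat)] `*` [set (k - i)%N]).
  rewrite -(bigcup_mkord _ (fun i => [set i] `*` [set (k - i)%N])).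
  apply/seteqP; split => [[i j] /= <-|[i j]].
    exists i => //=; first by rewrite /add_pair/= ltnS leq_addr.
    by rewrite /add_pair/= addKn.
  by move=> [l /= lk [/= -> ->]]; rewrite /add_pair/= subnKC.
rewrite -[LHS]/((mu \x nu) (add_pair @^-1` [set k])) preimE.
rewrite measure_semi_additive_ord//.
- by apply: eq_bigr => i _; exact: product_measure1E.
- by move=> i; exact: measurable_nat_pair.
- apply/trivIsetP => i j _ _ ij; apply/seteqP; split => // -[x y] /=.
  by move=> [[-> _] [/val_inj eij _]]; rewrite eij eqxx in ij.
- exact: measurable_nat_pair.
Qed.
End laws_on_nat.

(** * Comparison of binomial and Poisson laws *)

Section binomial_poisson.
Local Open Scope ereal_scope.
Context {R : realType}.

Lemma poisson_prob_set1 (r : R) n k : (0 <= r)%R ->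
  poisson_prob r n [set k] = (r ^+ k / k`!%:R * expR (- r))%:E.
Proof.
(* At rate zero [poisson_prob] is the Dirac mass at 0; the formula still holds there because
   [0 ^+ 0 = 1]. *)
rewrite le_eqVlt => /predU1P[<-|r0].
  rewrite /poisson_prob ltxx diracE oppr0 expR0 mulr1 expr0n.
  by case: k => [|k]; rewrite /=; [rewrite fact0 divr1 mem_set|
    rewrite mul0r memNset].
rewrite /poisson_prob r0 esum_set1 ?lee_fin ?poisson_pmf_ge0//.
by rewrite /poisson_pmf r0.
Qed.

Lemma binomial_prob_set1 (p : R) m k : (0 <= p <= 1)%R ->
  binomial_prob m p [set k] = (p ^+ k * (1 - p) ^+ (m - k) *+ 'C(m, k))%:E.
Proof.
move=> p01; rewrite /binomial_prob p01 esum_set1//.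
by rewrite lee_fin binomial_pmf_ge0.
Qed.

(** On atoms this is the binomial theorem for [(r + s) ^+ k] divided by the factorial of [k]. *)
Lemma poisson_probD (r s : R) n : (0 <= r)%R -> (0 <= s)%R ->
  convolution (poisson_prob r n) (poisson_prob s n) =
  poisson_prob (r + s) n :> (set nat -> \bar R).
Proof.
move=> r0 s0; apply: eq_measure_nat => k.
rewrite [LHS]convolution_set1 /= poisson_prob_set1 ?addr_ge0//.
under eq_bigr do rewrite !poisson_prob_set1// -EFinM.
rewrite sumEFin; congr _%:E.
rewrite addrC exprDn !mulr_suml; apply: eq_bigr => i _.
rewrite opprD expRD mulrACA [RHS]mulrAC.
have ik : (i <= k)%N by rewrite -ltnS.
have := bin_fact ik => /(congr1 (fun x => x%:R%R : R)); rewrite !natrM => <-.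
have h j : (j`!%:R != 0 :> R)%R by rewrite pnatr_eq0 -lt0n fact_gt0.
have c0 : ('C(k, i)%:R != 0 :> R)%R by rewrite pnatr_eq0 -lt0n bin_gt0.
by field; rewrite !h c0.
Qed.

(** On atoms this is Pascal's rule: the Bernoulli factor leaves only the terms for 0 and 1. *)
Lemma binomial_probS (p : R) m : (0 <= p <= 1)%R ->
  convolution (binomial_prob 1 p) (binomial_prob m p) =
  binomial_prob m.+1 p :> (set nat -> \bar R).
Proof.
move=> p01; apply: eq_measure_nat => k.
rewrite [LHS]convolution_set1 /= binomial_prob_set1//.
under eq_bigr do rewrite !binomial_prob_set1// -EFinM.
rewrite sumEFin; congr _%:E.
case: k => [|k].
  by rewrite big_ord1 !bin0 !expr0 !subn0 !mul1r -exprD.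
rewrite 2!big_ord_recl big1 ?addr0; last first.
  by move=> i _; rewrite [X in 'C(_, X)]lift0 bin_small// mul0r.
rewrite /= !bin0 bin1 expr0 subn0 expr1 mul1r subSS /=.
rewrite subn0 !mulr1n subnn expr0 mulr1.
rewrite subSS subn0 binS mulrnDr -!mulrnAr exprS.
(* The exponent [m - k.+1] is an honest predecessor of [m - k] only when [k < m]; otherwise the
   coefficient ['C(m, k.+1)] vanishes. *)
have [km|mk] := ltnP k m.
  by rewrite -(subnSK km) !exprS; ring.
rewrite (@bin_small m k.+1)// !mulr0n !mulr0 !add0r.
exact: mulrA.
Qed.

(** At 0 the comparison is [1 - p <= expR (- p)], and from 2 on the Bernoulli law has no mass. The
    excess at 1 is [p - p * expR (- p)]. *)
Lemma TV_bernoulli_poisson (p : R) n : (0 <= p <= 1)%R ->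
  TV (binomial_prob 1 p) (poisson_prob p n) <= (p * (1 - expR (- p)))%:E.
Proof.
move=> /[dup] p01 /andP[p0 p1].
apply: le_trans (@TV_le_atom _ (binomial_prob 1 p) (poisson_prob p n) 1%N _) _.
  case=> [|[//|k]] _ /=;
    rewrite binomial_prob_set1// poisson_prob_set1// lee_fin.
    rewrite bin0 subn0 !expr0 fact0 divr1 !mul1r expr1.
    exact: expR_ge1Dx.
  by rewrite bin_small// mulr0n mulr_ge0 ?expR_ge0// divr_ge0 ?exprn_ge0.
rewrite /= binomial_prob_set1// poisson_prob_set1// -EFinB lee_fin.
rewrite binn subnn expr0 expr1 (_ : 1`! = 1)%N//.
by rewrite divr1 mulr1 mulr1n mulrBr mulr1.
Qed.

Lemma TV_poisson (r s : R) n : (0 <= r)%R -> (0 <= s)%R ->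
  TV (poisson_prob r n) (poisson_prob s n) <= `|r - s|%:E.
Proof.
wlog rs : r s / (r <= s)%R.
  move=> h r0 s0; have [rs|/ltW sr] := leP r s; first exact: h.
  by rewrite TV_sym distrC; exact: h.
move=> r0 _; have d0 : (0 <= s - r)%R by rewrite subr_ge0.
(* The rates are split as [r + 0] and [r + (s - r)], so that the common factor of rate [r] costs
   nothing and only rates [0] and [s - r] are compared. *)
rewrite -{1}(addr0 r) -{1}(subrKC r s).
rewrite -(poisson_probD n r0 (lexx 0%R)) -(poisson_probD n r0 d0).
apply: le_trans (TV_convolution _ _ _ _) _; rewrite TV_refl add0e.
apply: le_trans (@TV_le_atom _ (poisson_prob 0%R n)
  (poisson_prob (s - r)%R n) 0%N _) _.
  case=> [//|k] _ /=; rewrite !poisson_prob_set1// lee_fin.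
  by rewrite expr0n/= !mul0r mulr_ge0 ?expR_ge0// divr_ge0 ?exprn_ge0.
rewrite /= !poisson_prob_set1// -EFinB lee_fin.
rewrite !expr0 fact0 divr1 !mul1r oppr0 expR0.
(* The excess at 0 is [1 - expR (- (s - r))], which is at most [s - r]. *)
rewrite ler0_norm ?subr_le0//.
by have := expR_ge1Dx (- (s - r)); lra.
Qed.

(* Le Cam's inequality in the special case of equal success probabilities. *)
Lemma TV_binomial_poisson (p : R) m n : (0 <= p <= 1)%R ->
  TV (binomial_prob m p) (poisson_prob (m%:R * p) n) <=
  (m%:R * p * (1 - expR (- p)))%:E.
Proof.
move=> /[dup] p01 /andP[p0 p1]; elim: m => [|m IHm].
  rewrite !mul0r.
  suff -> : binomial_prob 0 p = poisson_prob 0 n :> (set nat -> \bar R).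
    by rewrite TV_refl.
  apply: eq_measure_nat => k.
  rewrite /= binomial_prob_set1// poisson_prob_set1// oppr0 expR0.
  rewrite mulr1 sub0n mulr1.
  by case: k => [|k]; rewrite ?expr0 ?fact0 ?divr1// expr0n mul0r bin_small.
(* One Bernoulli factor and one Poisson factor of rate [p] are split off; the remaining factors are
   the induction hypothesis. *)
rewrite -binomial_probS// -natr1 mulrDl mul1r addrC -poisson_probD//; last first.
  by rewrite mulr_ge0.
apply: le_trans (TV_convolution _ _ _ _) _.
by rewrite mulrDl EFinD; apply: leeD => //; exact: TV_bernoulli_poisson.
Qed.

Lemma TV_binomial_poisson_le (p r : R) m n : (0 <= p <= 1)%R -> (0 <= r)%R ->
  TV (binomial_prob m p) (poisson_prob r n) <=
  (m%:R * p * (1 - expR (- p)) + `|m%:R * p - r|)%:E.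
Proof.
move=> /[dup] p01 /andP[p0 p1] r0.
apply: le_trans (TV_triangle _ (poisson_prob (m%:R * p) n) _) _.
rewrite EFinD; apply: leeD; first exact: TV_binomial_poisson.
by apply: TV_poisson => //; rewrite mulr_ge0.
Qed.
End binomial_poisson.

(** * The Le Cam distance on a common sample space *)

Section le_cam_distance_bound.
Local Open Scope ereal_scope.
Context {R : realType}.

Lemma kernel_image_dirac d (T : measurableType d) (mu : probability T R) A :
  measurable A ->
  kernel_image mu (kdirac (@measurable_id _ T setT) : R.-pker T ~> T) A = mu A.
Proof.
by move=> mA; rewrite -[in RHS](setIT A) -integral_indic.
Qed.

Lemma deficiency_ge0 d1 (T1 : measurableType d1) d2 (T2 : measurableType d2)
    (E : binary_experiment (R := R) T1) (F : binary_experiment (R := R) T2) :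
  0 <= deficiency E F.
Proof.
apply: le_ereal_inf_tmp => _ [K _ <-].
by rewrite le_max TV_ge0.
Qed.

Lemma deficiency_le_TV d (T : measurableType d)
    (E F : binary_experiment (R := R) T) :
  deficiency E F <= Order.max (TV E.1 F.1) (TV E.2 F.2).
Proof.
apply: ereal_inf_lbound.
exists (kdirac (@measurable_id _ T setT) : R.-pker T ~> T) => //.
have TV_id (mu nu : probability T R) :
    TV (kernel_image mu (kdirac (@measurable_id _ T setT) : R.-pker T ~> T)) nu =
    TV mu nu.
  rewrite /TV; congr ereal_sup; apply: eq_imagel => A mA.
  by rewrite kernel_image_dirac.
by rewrite !TV_id.
Qed.

Lemma le_cam_distance_ge0 d1 (T1 : measurableType d1) d2
    (T2 : measurableType d2) (E : binary_experiment (R := R) T1)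
    (F : binary_experiment (R := R) T2) :
  0 <= le_cam_distance E F.
Proof. by rewrite le_max deficiency_ge0. Qed.

(** Each deficiency is at most a maximum of two distances. Replacing it by their sum lets
    convergence to zero follow from additivity of limits. *)
Lemma le_cam_distance_le_TV d (T : measurableType d)
    (E F : binary_experiment (R := R) T) :
  le_cam_distance E F <= TV E.1 F.1 + TV E.2 F.2.
Proof.
have le_sum (E' F' : binary_experiment (R := R) T) :
    deficiency E' F' <= TV E'.1 F'.1 + TV E'.2 F'.2.
  apply: le_trans (deficiency_le_TV _ _) _.
  by rewrite ge_max leeDl ?leeDr ?TV_ge0.
rewrite ge_max le_sum/= (le_trans (le_sum _ _))//.
by rewrite (TV_sym F.1) (TV_sym F.2).
Qed.

End le_cam_distance_bound.

(** * Differences of independent counts and their Skellam approximation *)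

Section differences.
Local Open Scope ereal_scope.
Context {R : realType}.

Definition sub_pair (ij : nat * nat) : int := (ij.1%:Z - ij.2%:Z)%R.

(** An event about the difference is an event about the pair, whose law is a product by
    independence. The two pairs may live on different spaces, as only their laws enter. *)
Lemma TV_int_diff d1 (T1 : measurableType d1) (P1 : probability T1 R)
    d2 (T2 : measurableType d2) (P2 : probability T2 R)
    (X1 Y1 : {RV P1 >-> nat}) (X2 Y2 : {RV P2 >-> nat}) :
  independent_RVs X1 Y1 -> independent_RVs X2 Y2 ->
  TV (distribution P1 (int_diff X1 Y1)) (distribution P2 (int_diff X2 Y2)) <=
  TV (distribution P1 X1) (distribution P2 X2) +
  TV (distribution P1 Y1) (distribution P2 Y2).
Proof.
move=> XY1 XY2; apply: le_trans (TV_product _ _ _ _).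
apply: le_TV => A _.
have mA := measurable_nat_pair (sub_pair @^-1` A).
have := TV_ge (distribution P1 X1 \x distribution P1 Y1)
  (distribution P2 X2 \x distribution P2 Y2) mA.
by rewrite -!joint_law_independent.
Qed.

Lemma TV_int_succ d1 (T1 : measurableType d1) (P1 : probability T1 R)
    d2 (T2 : measurableType d2) (P2 : probability T2 R)
    (Z1 : {RV P1 >-> int}) (Z2 : {RV P2 >-> int}) :
  TV (distribution P1 (int_succ Z1)) (distribution P2 (int_succ Z2)) <=
  TV (distribution P1 Z1) (distribution P2 Z2).
Proof.
apply: le_TV => A _.
exact: (@TV_ge _ _ _ (distribution P1 Z1) (distribution P2 Z2)
  ((fun z : int => 1 + z)%R @^-1` A)).
Qed.

Lemma TV_binomial_skellam d1 (T1 : measurableType d1) (P1 : probability T1 R)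
    d2 (T2 : measurableType d2) (P2 : probability T2 R)
    (A B : {RV P1 >-> nat}) (X Y : {RV P2 >-> nat}) (p r s : R) m l n1 n2 :
  (0 <= p <= 1)%R -> (0 <= r)%R -> (0 <= s)%R ->
  distribution P1 A =1 binomial_prob m p ->
  distribution P1 B =1 binomial_prob l p ->
  independent_RVs A B ->
  distribution P2 X =1 poisson_prob r n1 ->
  distribution P2 Y =1 poisson_prob s n2 ->
  independent_RVs X Y ->
  TV (distribution P1 (int_diff A B)) (distribution P2 (int_diff X Y)) <=
  (m%:R * p * (1 - expR (- p)) + l%:R * p * (1 - expR (- p))
   + `|m%:R * p - r| + `|l%:R * p - s|)%:E.
Proof.
move=> p01 r0 s0 /funext A_law /funext B_law AB /funext X_law /funext Y_law XY.
apply: le_trans (TV_int_diff AB XY) _.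
rewrite A_law B_law X_law Y_law.
apply: le_trans (leeD (TV_binomial_poisson_le m n1 p01 r0)
  (TV_binomial_poisson_le l n2 p01 s0)) _.
by rewrite -EFinD lee_fin; lra.
Qed.

(** This rests on [1 - expR (- p) <= p]. In both applications [m + l] is the number of users. *)
Lemma binomial_skellam_bound_le (p x y : R) m l : (0 <= p)%R ->
  (m%:R * p * (1 - expR (- p)) + l%:R * p * (1 - expR (- p)) + x + y <=
   (m + l)%:R * p ^+ 2 + x + y)%R.
Proof.
move=> p0; rewrite !lerD2r -mulrDl -mulrDl -natrD expr2 mulrA.
apply: ler_wpM2l; first by rewrite mulr_ge0.
by have := expR_ge1Dx (- p); lra.
Qed.

End differences.

(** * Limits of the bounds and of the rates *)

Section limits.
Context {R : realType}.

(** The upper bound is asked only for positive [n], the range on which the laws are specified. *)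
Lemma cvge0_squeeze (u : nat -> \bar R) (v : nat -> R) :
  (forall n, 0%E <= u n)%E -> (forall n, (0 < n)%N -> (u n <= (v n)%:E)%E) ->
  v n @[n --> \oo] --> 0 -> u n @[n --> \oo] --> 0%E.
Proof.
move=> u0 uv v0; apply: (@squeeze_cvge _ _ _ _ (cst 0%E) _ (EFin \o v)).
- by near=> n; rewrite u0 uv//; near: n; exact: nbhs_infty_gt.
- exact: cvg_cst.
- by apply: cvg_EFin => //; near=> n.
Unshelve. all: by end_near. Qed.

Lemma cvg_eq_pos (u v : nat -> R) (l : R) :
  (forall n, (0 < n)%N -> u n = v n) ->
  u n @[n --> \oo] --> l -> v n @[n --> \oo] --> l.
Proof.
move=> uv; apply: cvg_trans; apply: near_eq_cvg; near=> n; apply: uv.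
by near: n; exact: nbhs_infty_gt.
Unshelve. all: by end_near. Qed.

Lemma cvg_invn : n%:R^-1 @[n --> \oo] --> (0 : R).
Proof. by rewrite -cvg_shiftS; exact: cvg_harmonic. Qed.

(** For positive [n] the product is the inverse of [n%:R^-1 + expR (eps n) / n%:R], whose limit is
    [a]. *)
Lemma cvg_mul_flip_rate (eps : nat -> R) (a : R) : a != 0 ->
  expR (eps n) / n%:R @[n --> \oo] --> a ->
  n%:R * (1 / (1 + expR (eps n))) @[n --> \oo] --> a^-1.
Proof.
move=> a0 ea.
have : (n%:R^-1 + expR (eps n) / n%:R)^-1 @[n --> \oo] --> (0 + a)^-1.
  apply: cvgV; first by rewrite add0r.
  by apply: cvgD => //; exact: cvg_invn.
rewrite add0r; apply: cvg_eq_pos => n n0.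
have n_neq0 : n%:R != 0 :> R by rewrite pnatr_eq0 -lt0n.
by rewrite -{1}[n%:R^-1]mul1r -mulrDl invf_div mul1r.
Qed.

End limits.

Theorem theorem4p1 (R : realType) (c pi0 : R) (eps0 : nat -> R)
  (k : nat -> nat)
  (c_gt0 : 0 < c) (pi0_gt0 : 0 < pi0) (pi0_lt1 : pi0 < 1)
  (eps0_gt0 : forall n, (0 < n)%N -> 0 < eps0 n)
  (k_lt : forall n, (0 < n)%N -> (k n < n)%N)
  (k_cvg : (k n)%:R / n%:R @[n --> \oo] --> pi0)
  (a_cvg : expR (eps0 n) / n%:R @[n --> \oo] --> c ^+ 2)
  (delta : nat -> R) (deltaE : forall n, delta n = 1 / (1 + expR (eps0 n)))
  (lambda0 lambda1 : R)
  (lambda0E : lambda0 = (1 - pi0) / c ^+ 2)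
  (lambda1E : lambda1 = pi0 / c ^+ 2)
  (* the pair (A_{n,k}, B_{n,k}) *)
  (d : nat -> measure_display) (T : forall n, measurableType (d n))
  (Pr : forall n, probability (T n) R)
  (A B : forall n, {RV Pr n >-> nat})
  (A_law : forall n, (0 < n)%N ->
    distribution (Pr n) (A n) =1 binomial_prob (n - k n) (delta n))
  (B_law : forall n, (0 < n)%N ->
    distribution (Pr n) (B n) =1 binomial_prob (k n) (delta n))
  (AB_indep : forall n, (0 < n)%N -> independent_RVs (A n) (B n))
  (* the pair (A'_{n,k}, B'_{n,k}) *)
  (d' : nat -> measure_display) (T' : forall n, measurableType (d' n))
  (Pr' : forall n, probability (T' n) R)
  (A' B' : forall n, {RV Pr' n >-> nat})
  (A'_law : forall n, (0 < n)%N ->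
    distribution (Pr' n) (A' n) =1 binomial_prob (n - k n - 1) (delta n))
  (B'_law : forall n, (0 < n)%N ->
    distribution (Pr' n) (B' n) =1 binomial_prob (k n + 1) (delta n))
  (AB'_indep : forall n, (0 < n)%N -> independent_RVs (A' n) (B' n))
  (* D = X - Y; the second argument of poisson_prob is a dummy *)
  (dS : measure_display) (S : measurableType dS) (PrS : probability S R)
  (X Y : {RV PrS >-> nat})
  (X_law : distribution PrS X =1 poisson_prob lambda0 0)
  (Y_law : distribution PrS Y =1 poisson_prob lambda1 0)
  (XY_indep : independent_RVs X Y) :
  let P n : probability int R := distribution (Pr n) (int_diff (A n) (B n)) in
  let Q n : probability int R :=
    distribution (Pr' n) (int_succ (int_diff (A' n) (B' n))) in
  let Pinf : probability int R := distribution PrS (int_diff X Y) in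
  let Qinf : probability int R := distribution PrS (int_succ (int_diff X Y)) in
  let lambda0_ n := (n - k n)%:R * delta n in
  let lambda1_ n := (k n)%:R * delta n in
  let lambda0'_ n := (n - k n - 1)%:R * delta n in
  let lambda1'_ n := (k n + 1)%:R * delta n in
  [/\ TV (P n) Pinf @[n --> \oo] --> 0%E,
      TV (Q n) Qinf @[n --> \oo] --> 0%E,
      le_cam_distance (P n, Q n) (Pinf, Qinf) @[n --> \oo] --> 0%E,
      forall n, (0 < n)%N ->
        let bound := (n - k n)%:R * delta n * (1 - expR (- delta n))
                     + (k n)%:R * delta n * (1 - expR (- delta n))
                     + `|lambda0_ n - lambda0| + `|lambda1_ n - lambda1| in
        (TV (P n) Pinf <= bound%:E)%E /\
        bound <= n%:R * delta n ^+ 2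
                 + `|lambda0_ n - lambda0| + `|lambda1_ n - lambda1| &
      forall n, (0 < n)%N ->
        let bound := (n - k n - 1)%:R * delta n * (1 - expR (- delta n))
                     + (k n + 1)%:R * delta n * (1 - expR (- delta n))
                     + `|lambda0'_ n - lambda0| + `|lambda1'_ n - lambda1| in
        (TV (Q n) Qinf <= bound%:E)%E /\
        bound <= n%:R * delta n ^+ 2
                 + `|lambda0'_ n - lambda0| + `|lambda1'_ n - lambda1|].
Proof.
move=> P Q Pinf Qinf l0 l1 l0' l1'.
have c2_gt0 : 0 < c ^+ 2 by rewrite exprn_gt0.
have d01 n : 0 <= delta n <= 1.
  have e0 := expR_ge0 (eps0 n).
  rewrite deltaE div1r invr_ge0 addr_ge0//= invf_le1; last first.
    by rewrite ltr_wpDr.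
  by rewrite lerDl.
have d0 n : 0 <= delta n by case/andP: (d01 n).
have L0 : 0 <= lambda0 by rewrite lambda0E divr_ge0// ?ltW// subr_gt0.
have L1 : 0 <= lambda1 by rewrite lambda1E divr_ge0// ltW.
have TVP n : (0 < n)%N -> (TV (P n) Pinf <=
    ((n - k n)%:R * delta n * (1 - expR (- delta n))
     + (k n)%:R * delta n * (1 - expR (- delta n))
     + `|l0 n - lambda0| + `|l1 n - lambda1|)%:E)%E.
  move=> n0; apply: TV_binomial_skellam => //.
  - exact: A_law.
  - exact: B_law.
  - exact: AB_indep.
have TVQ n : (0 < n)%N -> (TV (Q n) Qinf <=
    ((n - k n - 1)%:R * delta n * (1 - expR (- delta n))
     + (k n + 1)%:R * delta n * (1 - expR (- delta n))
     + `|l0' n - lambda0| + `|l1' n - lambda1|)%:E)%E.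
  move=> n0; apply: le_trans (TV_int_succ _ _) _.
  apply: TV_binomial_skellam => //.
  - exact: A'_law.
  - exact: B'_law.
  - exact: AB'_indep.
have boundP n : (0 < n)%N ->
    (n - k n)%:R * delta n * (1 - expR (- delta n))
     + (k n)%:R * delta n * (1 - expR (- delta n))
     + `|l0 n - lambda0| + `|l1 n - lambda1| <=
    n%:R * delta n ^+ 2 + `|l0 n - lambda0| + `|l1 n - lambda1|.
  move=> n0; rewrite -[X in X%:R * _ ^+ 2](subnK (ltnW (k_lt n n0))).
  exact: binomial_skellam_bound_le.
have boundQ n : (0 < n)%N ->
    (n - k n - 1)%:R * delta n * (1 - expR (- delta n))
     + (k n + 1)%:R * delta n * (1 - expR (- delta n))
     + `|l0' n - lambda0| + `|l1' n - lambda1| <=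
    n%:R * delta n ^+ 2 + `|l0' n - lambda0| + `|l1' n - lambda1|.
  (* The two truncated subtractions are exact because [k n < n], so the shifted counts still add up
     to [n]. *)
  move=> n0; have -> : n%:R = ((n - k n - 1) + (k n + 1))%:R :> R.
    by congr _%:R; have := k_lt _ n0; lia.
  exact: binomial_skellam_bound_le.
have nd_cvg : n%:R * delta n @[n --> \oo] --> (c ^+ 2)^-1.
  under eq_fun do rewrite deltaE.
  by apply: cvg_mul_flip_rate => //; rewrite gt_eqF.
(* For positive [n], [delta n] is the product of [n%:R^-1] and the convergent sequence
   [n%:R * delta n]. *)
have d_cvg : delta n @[n --> \oo] --> (0 : R).
  rewrite -(mul0r (c ^+ 2)^-1).
  apply: cvg_eq_pos (cvgM (@cvg_invn R) nd_cvg) => n n0 /=.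
  by rewrite mulKf// pnatr_eq0 -lt0n.
have nd2_cvg : n%:R * delta n ^+ 2 @[n --> \oo] --> (0 : R).
  rewrite -(mulr0 (c ^+ 2)^-1); under eq_fun do rewrite expr2 mulrA.
  exact: cvgM.
have l1_cvg : l1 n @[n --> \oo] --> lambda1.
  rewrite lambda1E; apply: cvg_eq_pos (cvgM k_cvg nd_cvg) => n n0 /=.
  by rewrite mulrA divfK// pnatr_eq0 -lt0n.
have l0_cvg : l0 n @[n --> \oo] --> lambda0.
  (* Both the limit and, for positive [n], the sequence are the total rate minus the rate of the
     ones. *)
  have -> : lambda0 = (c ^+ 2)^-1 - lambda1 by rewrite lambda0E lambda1E; ring.
  apply: cvg_eq_pos (cvgB nd_cvg l1_cvg) => n n0 /=.
  by rewrite /l0 natrB ?mulrBl// ltnW// k_lt.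
(* Moving one user from zero to one shifts each rate by a single [delta n], which vanishes in the
   limit. *)
have l0'_cvg : l0' n @[n --> \oo] --> lambda0.
  rewrite -(subr0 lambda0); apply: cvg_eq_pos (cvgB l0_cvg d_cvg) => n n0 /=.
  by rewrite /l0' natrB ?mulrBl ?mul1r// subn_gt0 k_lt.
have l1'_cvg : l1' n @[n --> \oo] --> lambda1.
  rewrite -(addr0 lambda1); apply: cvg_eq_pos (cvgD l1_cvg d_cvg) => n _ /=.
  by rewrite /l1' natrD mulrDl mul1r.
have dist0 (u : nat -> R) l :
    u n @[n --> \oo] --> l -> `|u n - l| @[n --> \oo] --> (0 : R).
  by move=> /cvgB/(_ (cvg_cst l))/cvg_norm; rewrite subrr normr0.
have bound_cvg (u v : nat -> R) : u n @[n --> \oo] --> lambda0 ->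
    v n @[n --> \oo] --> lambda1 ->
    n%:R * delta n ^+ 2 + `|u n - lambda0| + `|v n - lambda1| @[n --> \oo]
    --> (0 : R).
  move=> u_cvg v_cvg; rewrite -[X in _ --> X](addr0 0).
  rewrite -[X in _ --> X + _](addr0 0).
  by apply: cvgD; [apply: cvgD => //|]; exact: dist0.
have P_cvg : TV (P n) Pinf @[n --> \oo] --> 0%E.
  apply: cvge0_squeeze (bound_cvg _ _ l0_cvg l1_cvg) => n; first exact: TV_ge0.
  by move=> n0; apply: le_trans (TVP n n0) _; rewrite lee_fin boundP.
have Q_cvg : TV (Q n) Qinf @[n --> \oo] --> 0%E.
  apply: cvge0_squeeze (bound_cvg _ _ l0'_cvg l1'_cvg) => n; first exact: TV_ge0.
  by move=> n0; apply: le_trans (TVQ n n0) _; rewrite lee_fin boundQ.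
split => //.
(* The distance lies between zero and the sum of the two total variations, already known to tend to
   zero. *)
- apply: (@squeeze_cvge _ _ _ _ (cst 0%E) _
      (fun n => TV (P n) Pinf + TV (Q n) Qinf)%E).
  + by near=> n; rewrite le_cam_distance_ge0 le_cam_distance_le_TV.
  + exact: cvg_cst.
  + by rewrite -(adde0 0%E); apply: cvgeD.
- by move=> n n0; split; [exact: TVP|exact: boundP].
- by move=> n n0; split; [exact: TVQ|exact: boundQ].
Unshelve. all: by end_near. Qed.
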